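(* Fix positive constants $Z_p, e, m, n, \hbar, \beta$, put $\omega_p=(4\pi n e^2/m)^{1/2}$, and let $H>-1$ and $w$ be real constants. Suppose that the Langmuir dispersion law $$\omega_L(k)=\Big(\omega_p^2(1+H)+w k^2+\frac{\hbar^2k^4}{(2m)^2}\Big)^{1/2}$$ is well defined and positive for all $k\ge 0$, and that for every $k>0$ the loss function (as a measure in $\omega$) is the canonical one $$\frac{\mathcal L(k,\omega)}{\pi C_0(k)}=\frac{\omega_2^2-\omega_1^2}{\omega_2^2}\,\delta(\omega)+\frac{\omega_1^2}{2\omega_2^2}\big[\delta(\omega-\omega_2)+\delta(\omega+\omega_2)\big],$$ where $\omega_2=\omega_2(k)=\omega_L(k)$, $C_0(k)>0$, $\omega_1^2=\omega_1^2(k)=\omega_p^2/C_0(k)$ and $\omega_1(k)\le\omega_2(k)$. Then the stopping power $$-\frac{dE}{dx}(v)=\frac{2(Z_pe)^2}{\pi v^2}\int_0^\infty\frac{dk}{k}\int_{-kv}^{kv}\omega^2 n_B(\omega)\,\mathcal L(k,\omega)\,d\omega$$ satisfies, as $v\to\infty$, $$-\frac{dE}{dx}(v)=\Big(\frac{Z_pe\,\omega_p}{v}\Big)^2\left[\ln\frac{2mv^2}{\hbar\omega_p\sqrt{1+H}}+o(1)\right].$$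
   Context: Here $n_B(\omega)=(1-\exp(-\beta\hbar\omega))^{-1}$ for $\omega\ne0$, and $\omega^2n_B(\omega)$ is extended by continuity with the value $0$ at $\omega=0$. The function $\mathcal L(k,\omega)=-\omega^{-1}\operatorname{Im}\epsilon^{-1}(k,\omega)$ is the loss function of a plasma with dielectric function $\epsilon(k,\omega)$; here it is a nonnegative measure in $\omega$ for each $k$, and the inner integral over $(-kv,kv)$ is the integral of $\omega^2n_B(\omega)$ against that measure. Frequency moments are $C_\nu(k)=\pi^{-1}\int_{-\infty}^\infty\omega^\nu\mathcal L(k,\omega)\,d\omega$, with $C_2(k)=\omega_p^2$, $\omega_1^2=C_2/C_0$, $\omega_2^2=C_4/C_2$. Physical meaning of the constants (not needed beyond the stated hypotheses): $Z_pe$ and $v$ are the charge and speed of a heavy projectile; $m,n$ are the electron mass and density; $\beta^{-1}$ is the temperature in energy units; $H=(g_{ei}(0)-1)/3$ with $g_{ei}$ the electron-ion radial distribution function; $w=2\langle v_e^2\rangle-v_{ee}^2$, where $\langle v_e^2\rangle$ is the average squared characteristic electron velocity and $v_{ee}^2$ is a constant determined by the electron-electron interaction energy density. The projectile is treated as infinitely heavy compared with the electrons (terms of relative order $m/M$, $M$ the projectile mass, are dropped), so the inner integration limits $\pm kv+\hbar k^2/(2M)$ are replaced by $\pm kv$. *)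

(* Defs.v *)
From HB Require Import structures.
From mathcomp Require Import all_boot all_order all_algebra.
From mathcomp Require Import all_classical all_reals all_analysis.

Set Implicit Arguments.
Unset Strict Implicit.
Unset Printing Implicit Defensive.

Import Order.TTheory GRing.Theory Num.Theory.
Import numFieldNormedType.Exports.

Local Open Scope classical_set_scope.
Local Open Scope ring_scope.

(* L k is the loss function at wave number k, a nonnegative Borel measure in
   the frequency: L k A stands for the integral of L(k, omega) over A. *)
Definition loss_function (R : realType) :=
  R -> {measure set (measurableTypeR R) -> \bar R}.

(* C_nu(k). Rintegral is 0 when the integral is not finite; in the theorem the
   moments of order 0, 2 and 4 are all constrained to be positive. *)
Definition moment (R : realType) (L : loss_function R) (nu : nat) (k : R) : R :=
  pi^-1 * \int[L k]_omega (omega ^+ nu).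

Definition omega1 (R : realType) (L : loss_function R) (k : R) : R :=
  Num.sqrt (moment L 2 k / moment L 0 k).

Definition omega2 (R : realType) (L : loss_function R) (k : R) : R :=
  Num.sqrt (moment L 4 k / moment L 2 k).

Definition plasma_frequency (R : realType) (e m n : R) : R :=
  Num.sqrt (4 * pi * n * e ^+ 2 / m).

Definition langmuir_radicand (R : realType) (omegap m hbar H w k : R) : R :=
  omegap ^+ 2 * (1 + H) + w * k ^+ 2 + hbar ^+ 2 * k ^+ 4 / (2 * m) ^+ 2.

Definition omegaL (R : realType) (omegap m hbar H w k : R) : R :=
  Num.sqrt (langmuir_radicand omegap m hbar H w k).

(* As an identity between Borel measures, with L divided by pi C_0(k). *)
Definition canonical_loss (R : realType) (L : loss_function R) (k : R) : Prop :=
  forall A : set (measurableTypeR R), measurable A ->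
    (((pi * moment L 0 k)^-1)%:E * L k A =
     ((omega2 L k ^+ 2 - omega1 L k ^+ 2) / omega2 L k ^+ 2)%:E * \d_(0%R : R) A
     + (omega1 L k ^+ 2 / (2 * omega2 L k ^+ 2))%:E
       * (\d_(omega2 L k) A + \d_((- omega2 L k)%R) A))%E.

Definition nB (R : realType) (beta hbar omega : R) : R :=
  (1 - expR (- (beta * hbar * omega)))^-1.

Definition omega2_nB (R : realType) (beta hbar omega : R) : R :=
  if omega == 0 then 0 else omega ^+ 2 * nB beta hbar omega.

(* -dE/dx, with values in the extended reals. *)
Definition stopping_power (R : realType) (Zp e hbar beta : R)
    (L : loss_function R) (v : R) : \bar R :=
  ((2 * (Zp * e) ^+ 2 / (pi * v ^+ 2))%:E *
   \int[lebesgue_measure]_(k in `]0%R, +oo[)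
     ((k^-1)%:E *
      \int[L k]_(omega in `](- (k * v))%R, (k * v)%R[)
        (omega2_nB beta hbar omega)%:E))%E.

(* Main.v *)
Require Import Defs.
From HB Require Import structures.
From mathcomp Require Import all_boot all_order all_algebra.
From mathcomp Require Import all_classical all_reals all_analysis.
From mathcomp Require Import measurable_realfun ring lra.

Import Order.TTheory GRing.Theory Num.Theory.
Import numFieldNormedType.Exports.

Local Open Scope classical_set_scope.
Local Open Scope ring_scope.

(* The central Dirac mass does not contribute, and the masses at [+- omega2 k]
   contribute only when [omega2 k < k v]; the inner integral is then
   [pi omega_p^2 / 2], because the Bose factors at opposite frequencies add up
   to [1].  The condition [omega2 k < k v] is quadratic in [k^2], so for large
   [v] it cuts out an interval of wave numbers and the outer integral of [1/k]
   is the logarithm of the ratio of its endpoints.  The product of the two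
   roots is constant, and the larger one is asymptotically [v^2 (2m/hbar)^2]. *)

(** * The logarithmic integral of [1/x] *)

Lemma measurable_inv_itvoo (R : realType) (a b : R) : 0 < a ->
  measurable_fun `]a, b[ (fun x : R => x^-1).
Proof.
move=> a0; apply: open_continuous_measurable_fun => //.
move=> x /[!inE]/=; rewrite in_itv/= => /andP[ax _].
by apply: continuousV; [exact: lt0r_neq0 (lt_trans a0 ax)|exact: cvg_id].
Qed.

Lemma integral_inv_itvoo (R : realType) (a b : R) : 0 < a -> a < b ->
  (\int[lebesgue_measure]_(x in `]a, b[) (x^-1)%:E = (ln b - ln a)%:E)%E.
Proof.
move=> a0 ab; have b0 := lt_trans a0 ab.
rewrite -(integral_itv_bndoo true false); last first.
  by apply/measurable_EFinP; exact: measurable_inv_itvoo.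
rewrite (@continuous_FTC2 _ _ (@ln R)) ?EFinB//.
- apply: continuous_in_subspaceT => x /[!inE]/=; rewrite in_itv/= => /andP[ax _].
  by apply: continuousV; [exact: lt0r_neq0 (lt_le_trans a0 ax)|exact: cvg_id].
- split.
  + move=> x; rewrite in_itv/= => /andP[ax _].
    by have [] := is_derive1_ln (lt_trans a0 ax).
  + by apply: cvg_at_right_filter; exact: continuous_ln.
  + by apply: cvg_at_left_filter; exact: continuous_ln.
- move=> x; rewrite in_itv/= => /andP[ax _].
  by rewrite derive1E; have [] := is_derive1_ln (lt_trans a0 ax).
Qed.

(** * Integration against three Dirac masses *)

Lemma ge0_integral_dirac3 (R : realType) d (T : measurableType d)
    (mu : {measure set T -> \bar R}) (c1 c2 : R) (x y z : T) (D : set T)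
    (f : T -> \bar R) :
  0 <= c1 -> 0 <= c2 ->
  (forall A, measurable A ->
    mu A = c1%:E * \d_x A + c2%:E * (\d_y A + \d_z A))%E ->
  measurable D -> measurable_fun D f -> (forall t, D t -> 0 <= f t)%E ->
  (\int[mu]_(t in D) f t =
   c1%:E * (\d_x D * f x) + c2%:E * (\d_y D * f y + \d_z D * f z))%E.
Proof.
move=> c1_ge0 c2_ge0 muE mD mf f0.
rewrite (eq_measure_integral (measure_add (mscale (NngNum c1_ge0) \d_x)
  (mscale (NngNum c2_ge0) (measure_add \d_y \d_z)))); last first.
  by move=> A mA _; rewrite muE// -[in LHS]measure_addE [RHS]measure_addE.
by rewrite ge0_integral_measure_add// !ge0_integral_mscale//=
  ge0_integral_measure_add// !integral_dirac.
Qed.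

(** The signed version is what the Bose weight calls for: [omega2_nB] is negative at negative
    frequencies. Positive and negative parts are integrated separately; both integrals are finite,
    so their difference makes sense. *)
Lemma integral_dirac3 (R : realType) d (T : measurableType d)
    (mu : {measure set T -> \bar R}) (c1 c2 : R) (x y z : T) (D : set T)
    (f : T -> R) :
  0 <= c1 -> 0 <= c2 ->
  (forall A, measurable A ->
    mu A = c1%:E * \d_x A + c2%:E * (\d_y A + \d_z A))%E ->
  measurable D -> measurable_fun D f ->
  (\int[mu]_(t in D) (f t)%:E =
   (c1 * ((x \in D)%:R * f x) +
    c2 * ((y \in D)%:R * f y + (z \in D)%:R * f z))%:E)%E.
Proof.
move=> c1_ge0 c2_ge0 muE mD /measurable_EFinP mf.
rewrite integralE !(ge0_integral_dirac3 _ _ _ _ _ _ _ _ _ _ _ c1_ge0 c2_ge0 muE)//.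
- rewrite !diracE !funeposE !funenegE -!EFinN -!EFin_max.
  rewrite -?EFinM -?EFinD -?EFinM -?EFinD.
  congr EFin.
  have E (r : R) : r = Num.max r 0 - Num.max (- r) 0.
    by rewrite /Num.max; do 2 case: ltP => ?; lra.
  (* The first two occurrences of each value sit inside the positive and negative parts; the third
     is the one on the right-hand side. *)
  rewrite {3}(E (f x)) {3}(E (f y)) {3}(E (f z)); ring.
- exact: measurable_funeneg.
- exact: measurable_funepos.
Qed.

(** * The Bose weight *)

Lemma measurable_omega2_nB (R : realType) (beta hbar : R) :
  0 < beta -> 0 < hbar -> measurable_fun setT (omega2_nB beta hbar).
Proof.
move=> beta0 hbar0; apply: measurable_fun_if => //.
- exact: measurable_fun_eqr.
- rewrite setTI (_ : _ @^-1` _ = ~` [set 0 : R]); last first.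
    by apply/seteqP; split=> x /=; [move=> /eqP|move/eqP/negPf].
  (* The case split isolates the point [0]; on its open complement the denominator of [nB] does not
     vanish, so the weight is continuous there. *)
  apply: open_continuous_measurable_fun.
    by apply: closed_openC; exact: closed_eq.
  move=> x /[!inE]/= /eqP x0; rewrite /nB.
  apply: cvgM; first exact: exprn_continuous.
  apply: cvgV.
    rewrite subr_eq0 eq_sym; apply/negP => /eqP.
    rewrite -expR0 => /expR_inj/eqP.
    by rewrite oppr_eq0 !mulf_eq0 (negPf x0) !gt_eqF.
  apply: cvgB; first exact: cvg_cst.
  apply: (@continuous_comp _ _ _ (fun x : R => - (beta * hbar * x)) expR); last exact: continuous_expR.
  by apply: cvgN; apply: cvgM; [exact: cvg_cst|exact: cvg_id].
Qed.

(* [nB x + nB (- x) = 1]: emission and absorption combine into a weight that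
   no longer depends on the temperature. *)
Lemma omega2_nBDN (R : realType) (beta hbar x : R) :
  0 < beta -> 0 < hbar -> x != 0 ->
  omega2_nB beta hbar x + omega2_nB beta hbar (- x) = x ^+ 2.
Proof.
move=> beta0 hbar0 x0; rewrite /omega2_nB oppr_eq0 (negPf x0) /nB mulrN opprK.
have t0 : beta * hbar * x != 0 by rewrite !mulf_neq0// gt_eqF.
set t := beta * hbar * x in t0 *.
have e0 : expR t != 0 by rewrite gt_eqF ?expR_gt0.
have e1 : expR t - 1 != 0.
  by rewrite subr_eq0 -expR0; apply: contra t0 => /eqP/expR_inj ->.
have e2 : 1 - expR t != 0 by rewrite -oppr_eq0 opprB.
rewrite expRN; field.
by rewrite e0 e1 e2.
Qed.

(** * The resonance window and its logarithmic length *)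

(* The resonance condition is quadratic in [b * k ^+ 2], with roots [M] and [P]. *)
Lemma resonance_window (R : realType) (a b w v M P k : R) :
  0 < b -> 0 < M -> M < P -> 0 < k -> M * P = a * b -> M + P = v ^+ 2 - w ->
  (a + w * k ^+ 2 + b * k ^+ 4 < (k * v) ^+ 2) =
  (Num.sqrt (M / b) < k < Num.sqrt (P / b)).
Proof.
move=> b0 M0 MP k0 prodE sumE.
have P0 := lt_trans M0 MP.
have kE : k = Num.sqrt (k ^+ 2) by rewrite sqrtr_sqr gtr0_norm.
rewrite [in RHS]kE !ltr_sqrt ?divr_gt0 ?exprn_gt0//.
rewrite ltr_pdivrMr// ltr_pdivlMr// -(ltr_pM2r b0).
(* By Vieta, [b] times the difference of the two sides factors over the roots [M] and [P]. *)
have -> : ((a + w * k ^+ 2 + b * k ^+ 4) * b < (k * v) ^+ 2 * b) =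
    ((k ^+ 2 * b - M) * (k ^+ 2 * b - P) < 0).
  rewrite -subr_lt0; congr (_ < 0).
  have vE : v ^+ 2 = M + P + w by rewrite sumE subrK.
  by rewrite exprMn vE; ring: prodE.
apply/idP/andP => [lt0|[lt1 lt2]]; last by rewrite pmulr_rlt0 ?subr_lt0 ?subr_gt0.
by split; rewrite ltNge; apply/negP => ?; move: lt0; rewrite ltNge => /negP; apply; nra.
Qed.

(** The error term is explicit: if the larger root is [v ^+ 2 * q v^-1], then [r v = ln (q v^-1)],
    and [q] is continuous with [q 0 = 1]. *)
Lemma log_window_asymptotics (R : realType) (a b w c : R) :
  0 < a -> 0 < b -> 0 <= c ->
  exists r : R -> R, r v @[v --> +oo] --> (0 : R) /\
    \forall v \near +oo,
      (\int[lebesgue_measure]_(k in `]0%R, +oo[)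
        (k^-1 * (if a + w * k ^+ 2 + b * k ^+ 4 < (k * v) ^+ 2 then c else 0))%:E
      = (c * (ln (v ^+ 2 / Num.sqrt (a * b)) + r v))%:E)%E.
Proof.
move=> a0 b0 c0.
have ab0 : 0 < a * b by rewrite mulr_gt0.
(* With [X = b * k ^+ 2] the roots solve [X ^+ 2 - (v ^+ 2 - w) * X + a * b = 0]. Putting
   [X = v ^+ 2 * Z] and [y = v^-1] gives [Z ^+ 2 - s y * Z + a * b * y ^+ 4 = 0], whose discriminant
   is [D y] and whose larger root is [q y]. The limit in [v] becomes continuity at [y = 0]. *)
pose s (y : R) := 1 - w * y ^+ 2.
pose D (y : R) := s y ^+ 2 - 4 * (a * b) * y ^+ 4.
pose q (y : R) := (s y + Num.sqrt (D y)) / 2.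
have s_cont : continuous s.
  move=> y; apply: cvgB; first exact: cvg_cst.
  by apply: cvgM; [exact: cvg_cst|exact: exprn_continuous].
have D_cont : continuous D.
  move=> y; apply: cvgB.
    exact: (@continuous_comp _ _ _ s (fun x => x ^+ 2) y (s_cont y) (@exprn_continuous _ _ _)).
  by apply: cvgM; [exact: cvg_cst|exact: exprn_continuous].
have q_cont : continuous q.
  move=> y; apply: cvgM; last exact: cvg_cst.
  apply: cvgD; first exact: s_cont.
  exact: (@continuous_comp _ _ _ D Num.sqrt y (D_cont y) (@sqrt_continuous _ _)).
have s0E : s 0 = 1 by rewrite /s expr0n/= mulr0 subr0.
have D0E : D 0 = 1 by rewrite /D s0E expr1n expr0n/= mulr0 subr0.
have q0E : q 0 = 1 by rewrite /q s0E D0E sqrtr1 divff.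
have inv0 : v^-1 @[v --> +oo] --> (0 : R).
  by apply/gtr0_cvgV0; [exact: nbhs_pinfty_gt|exact: cvg_id].
have invcomp (f : R -> R) : continuous f -> f v^-1 @[v --> +oo] --> f 0.
  by move=> fc; apply: (cvg_comp _ _ inv0); exact: fc.
exists (fun v => ln (q v^-1)); split.
  rewrite -[X in _ --> X](@ln1 R) -q0E.
  apply: (cvg_comp _ _ (invcomp q q_cont)).
  by apply: continuous_ln; rewrite q0E.
near=> v.
have v0 : 0 < v by near: v; exact: nbhs_pinfty_gt.
have s_gt0 : 0 < s v^-1.
  by near: v; apply: (cvgr_gt _ (invcomp s s_cont)); rewrite s0E.
have D_gt0 : 0 < D v^-1.
  by near: v; apply: (cvgr_gt _ (invcomp D D_cont)); rewrite D0E.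
have v_neq0 : v != 0 by rewrite gt_eqF.
pose t := Num.sqrt (D v^-1).
have t0 : 0 < t by rewrite sqrtr_gt0.
have t2 : t ^+ 2 = D v^-1 by rewrite sqr_sqrtr// ltW.
(* This makes the smaller root positive, so the window stays away from [k = 0]. *)
have t_lt : t < s v^-1.
  rewrite -(@ltr_pXn2r _ 2) ?nnegrE ?ltW// t2 /D gtrBl.
  by rewrite mulr_gt0 ?exprn_gt0 ?invr_gt0// mulr_gt0.
pose P := v ^+ 2 * q v^-1.
pose M := v ^+ 2 * ((s v^-1 - t) / 2).
have M0 : 0 < M by rewrite mulr_gt0 ?exprn_gt0// divr_gt0// subr_gt0.
have MP : M < P.
  rewrite ltr_pM2l ?exprn_gt0// ltr_pM2r// -/t; lra.
have P0 := lt_trans M0 MP.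
have prodE : M * P = a * b.
  have -> : M * P = v ^+ 4 * ((s v^-1) ^+ 2 - t ^+ 2) / 4.
    by rewrite /M /P /q -/t; field.
  by rewrite t2 /D; field.
have sumE : M + P = v ^+ 2 - w.
  by rewrite /M /P /q -/t /s; field.
pose x := Num.sqrt (M / b); pose y := Num.sqrt (P / b).
have x0 : 0 < x by rewrite sqrtr_gt0 divr_gt0.
have xy : x < y by rewrite ltr_sqrt ?divr_gt0// ltr_pM2r ?invr_gt0.
have y0 := lt_trans x0 xy.
transitivity (\int[lebesgue_measure]_(k in `]0%R, +oo[ `&` `]x, y[)
    (c%:E * (k^-1)%:E))%E.
  rewrite integral_mkcondr; apply: eq_integral => k.
  rewrite inE/= in_itv/= andbT => k0.
  rewrite patchE mem_setE in_itv/= -(resonance_window _ _ _ _ _ _ _ _ b0 M0 MP k0 prodE sumE).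
  by case: ifP => _; rewrite ?mulr0// -EFinM mulrC.
have -> : (`]0, +oo[ `&` `]x, y[ = `]x, y[ :> set R)%classic.
  apply/setIidPr => k /=; rewrite !in_itv/= andbT => /andP[xk _].
  exact: lt_trans xk.
rewrite ge0_integralZl//; last 2 first.
- by apply/measurable_EFinP; exact: measurable_inv_itvoo.
- move=> k /=; rewrite in_itv/= => /andP[xk _].
  by rewrite lee_fin invr_ge0 ltW// (lt_trans x0).
rewrite integral_inv_itvoo// -EFinM; congr (_ * _)%:E.
rewrite -ln_div ?posrE// -lnM ?posrE; last 2 first.
- by rewrite divr_gt0 ?exprn_gt0// sqrtr_gt0.
- by rewrite -(pmulr_rgt0 _ (exprn_gt0 2 v0)).
have x2 : x ^+ 2 = M / b by rewrite sqr_sqrtr// divr_ge0// ltW.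
have y2 : y ^+ 2 = P / b by rewrite sqr_sqrtr// divr_ge0// ltW.
(* The ratio [y / x] equals [y ^+ 2 / (x * y)], that is [P / Num.sqrt (M * P)]: the product of the
   roots supplies [Num.sqrt (a * b)], and [P] supplies [v ^+ 2 * q v^-1]. *)
have -> : Num.sqrt (a * b) = b * (x * y).
  have -> : a * b = (b * (x * y)) ^+ 2.
    by rewrite -prodE !exprMn x2 y2; field; rewrite gt_eqF.
  by rewrite sqrtr_sqr gtr0_norm// !mulr_gt0.
have -> : v ^+ 2 / (b * (x * y)) * q v^-1 = y ^+ 2 * b / (b * (x * y)).
  by rewrite y2 divfK ?gt_eqF// mulrAC.
by congr ln; field; rewrite !gt_eqF.
Unshelve. all: by end_near. Qed.

(** * The inner integral *)

Lemma canonical_loss_integral (R : realType) (beta hbar k z : R)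
    (L : loss_function R) :
  0 < beta -> 0 < hbar -> 0 < moment L 0 k -> 0 < moment L 2 k ->
  0 < omega2 L k -> omega1 L k <= omega2 L k -> canonical_loss L k ->
  (\int[L k]_(omega in `](- z)%R, z%R[) (omega2_nB beta hbar omega)%:E =
   (if omega2 L k < z then pi * moment L 2 k / 2 else 0)%:E)%E.
Proof.
move=> beta0 hbar0 C0 C2 w2 w12 Lk.
set W := omega2 L k in w2 w12 *.
have w1 : omega1 L k ^+ 2 = moment L 2 k / moment L 0 k.
  by rewrite sqr_sqrtr// divr_ge0// ltW.
set K := pi * moment L 0 k.
have K0 : 0 < K by rewrite mulr_gt0 ?pi_gt0.
(* The masses of [L k] itself, with the normalization by [pi * moment L 0 k] undone. The hypothesis
   [omega1 L k <= omega2 L k] makes the central mass nonnegative. *)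
pose c1 := K * ((W ^+ 2 - omega1 L k ^+ 2) / W ^+ 2).
pose c2 := K * (omega1 L k ^+ 2 / (2 * W ^+ 2)).
have W2 : 0 < W ^+ 2 by rewrite exprn_gt0.
have c1_ge0 : 0 <= c1.
  rewrite mulr_ge0 ?(ltW K0)// divr_ge0 ?(ltW W2)// subr_ge0.
  by rewrite ler_sqr ?nnegrE ?sqrtr_ge0// ltW.
have c2_ge0 : 0 <= c2.
  by rewrite mulr_ge0 ?(ltW K0)// divr_ge0 ?sqr_ge0// mulr_ge0 ?(ltW W2).
rewrite (@integral_dirac3 _ _ _ (L k) c1 c2 0 W (- W) _ _ c1_ge0 c2_ge0)//;
    last 2 first.
- move=> A mA; have := congr1 (fun u => K%:E * u)%E (Lk A mA).
  rewrite muleA -EFinM divff ?gt_eqF// mul1e => ->.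
  rewrite muleDr; last 2 first.
  + by [].
  + by rewrite !diracE -!EFinD -!EFinM.
  by rewrite !muleA -!EFinM.
- by apply: measurable_funTS; exact: measurable_omega2_nB.
(* The interval is symmetric and [W > 0], so both outer masses lie in it under the same
   condition. *)
have -> : (W \in `](- z), z[%classic) = (W < z).
  by rewrite mem_setE in_itv/=; apply: andb_idl => Wz; lra.
have -> : (- W \in `](- z), z[%classic) = (W < z).
  by rewrite mem_setE in_itv/= ltrN2; apply: andb_idr => Wz; lra.
rewrite {1}/omega2_nB eqxx !mulr0 add0r.
case: ifP => _; last by rewrite !mul0r addr0 mulr0.
(* The sum of the Bose weights is [W ^+ 2], which cancels the denominator of [c2]; the zeroth moment
   cancels because [omega1 L k ^+ 2] is the quotient of the second moment by it. *)
rewrite !mul1r omega2_nBDN ?gt_eqF// /c2 /K w1; congr EFin; field.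
by rewrite !gt_eqF.
Qed.

Theorem mainTheorem1 (R : realType) (Zp e m n hbar beta H w : R)
    (L : loss_function R)
    (Zp_gt0 : 0 < Zp) (e_gt0 : 0 < e) (m_gt0 : 0 < m) (n_gt0 : 0 < n)
    (hbar_gt0 : 0 < hbar) (beta_gt0 : 0 < beta) (H_gtN1 : -1 < H) :
  let omegap := plasma_frequency e m n in
  (forall k : R, 0 <= k ->
     0 <= langmuir_radicand omegap m hbar H w k /\
     0 < omegaL omegap m hbar H w k) ->
  (forall k : R, 0 < k ->
     [/\ 0 < moment L 0 k,
         moment L 2 k = omegap ^+ 2,
         omega2 L k = omegaL omegap m hbar H w k,
         omega1 L k <= omega2 L k &
         canonical_loss L k]) ->
  exists r : R -> R,
    r v @[v --> +oo] --> (0 : R) /\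
    \forall v \near +oo,
      stopping_power Zp e hbar beta L v =
      ((Zp * e * omegap / v) ^+ 2 *
       (ln (2 * m * v ^+ 2 / (hbar * omegap * Num.sqrt (1 + H))) + r v))%:E.
Proof.
move=> omegap rad_gt0 canonical.
have omegap_gt0 : 0 < omegap.
  by rewrite sqrtr_gt0 divr_gt0// !mulr_gt0 ?exprn_gt0 ?pi_gt0.
clearbody omegap.
have omegap2_gt0 : 0 < omegap ^+ 2 by rewrite exprn_gt0.
have H1_gt0 : 0 < 1 + H by rewrite -ltrBlDl sub0r.
(* The radicand is [a + w * k ^+ 2 + b * k ^+ 4]. Since [w] does not enter the product [a * b] of
   the roots, it affects only the error term. *)
pose a := omegap ^+ 2 * (1 + H).
pose b := hbar ^+ 2 / (2 * m) ^+ 2.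
have m2_gt0 : 0 < 2 * m by rewrite mulr_gt0.
have a_gt0 : 0 < a by rewrite mulr_gt0.
have b_gt0 : 0 < b by rewrite divr_gt0 ?exprn_gt0.
have c_ge0 : 0 <= pi * omegap ^+ 2 / 2.
  by rewrite divr_ge0// mulr_ge0 ?pi_ge0// ltW.
have [r [r0 rE]] := log_window_asymptotics _ a b w _ a_gt0 b_gt0 c_ge0.
exists r; split => //; near=> v.
have v_gt0 : 0 < v by near: v; exact: nbhs_pinfty_gt.
have ln_arg : v ^+ 2 / Num.sqrt (a * b) =
    2 * m * v ^+ 2 / (hbar * omegap * Num.sqrt (1 + H)).
  have -> : a * b = (omegap * Num.sqrt (1 + H) * (hbar / (2 * m))) ^+ 2.
    by rewrite exprMn exprMn expr_div_n (sqr_sqrtr (ltW H1_gt0)).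
  rewrite sqrtr_sqr gtr0_norm ?mulr_gt0 ?sqrtr_gt0 ?invr_gt0//.
  by field; rewrite !gt_eqF ?sqrtr_gt0.
(* The prefactor [2 * (Zp * e) ^+ 2 / (pi * v ^+ 2)] times the resonant value [pi * omegap ^+ 2 / 2]
   is [(Zp * e * omegap / v) ^+ 2]. *)
rewrite /stopping_power (_ : (\int[_]_(k in _) _)%E = (pi * omegap ^+ 2 / 2 *
    (ln (2 * m * v ^+ 2 / (hbar * omegap * Num.sqrt (1 + H))) + r v))%:E)%E.
  rewrite -EFinM; congr EFin.
  by move: pi (pi_gt0 R) => p p_gt0; field; rewrite !gt_eqF.
rewrite -ln_arg; transitivity (\int[lebesgue_measure]_(k in `]0%R, +oo[)
    (k^-1 * (if a + w * k ^+ 2 + b * k ^+ 4 < (k * v) ^+ 2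
             then pi * omegap ^+ 2 / 2 else 0))%:E)%E; last by near: v; exact: rE.
apply: eq_integral => k.
rewrite inE/= in_itv/= andbT => k_gt0.
have [C0 C2 w2E w12 Lk] := canonical k k_gt0.
have [rad_ge0 wL_gt0] := rad_gt0 k (ltW k_gt0).
rewrite canonical_loss_integral ?C2 ?w2E -?w2E// ?w2E// -EFinM.
have kv_gt0 : 0 < k * v by rewrite mulr_gt0.
suff -> : (omegaL omegap m hbar H w k < k * v) =
    (a + w * k ^+ 2 + b * k ^+ 4 < (k * v) ^+ 2) by [].
rewrite -[X in _ < X](gtr0_norm kv_gt0) -sqrtr_sqr ltr_sqrt ?exprn_gt0//.
by rewrite /langmuir_radicand /b [_ / _ * _]mulrAC.
Unshelve. all: by end_near. Qed.
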